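(* Let $T>0$ and let $f:[0,T]\to\mathbb{R}$ be a continuous function of bounded variation. Let $f^{*}(t):=\max_{0\le s\le t} f(s)$ for $t\in[0,T]$, and let $\mu_f$ be the signed Lebesgue--Stieltjes measure induced by $f$. Then $$f^{*}(T)=f(0)+\int_{0}^{T}\mathbf{1}_{\{f^{*}(t)=f(t)\}}\,d\mu_f(t).$$
   Context: The function $f^{*}$ is called the running maximum of $f$. For a continuous function $f:[0,T]\to\mathbb{R}$ of bounded variation, $\mu_f$ is the (atomless) finite signed Borel measure on $[0,T]$ with $\mu_f((a,b])=f(b)-f(a)$ for $0\le a<b\le T$. The integral is a Lebesgue--Stieltjes integral, i.e. the integral of the indicator function of $\{t\in[0,T]: f^{*}(t)=f(t)\}$ with respect to $\mu_f$. *)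

(* Defs.v *)
From HB Require Import structures.
From mathcomp Require Import all_boot all_order all_algebra.
From mathcomp Require Import all_classical all_reals all_analysis.
From mathcomp Require Import ring lra.

Set Implicit Arguments.
Unset Strict Implicit.
Unset Printing Implicit Defensive.

Import Order.TTheory GRing.Theory Num.Theory.
Import numFieldNormedType.Exports.

Local Open Scope classical_set_scope.
Local Open Scope ring_scope.

Section signed_integral.
Context {d : measure_display} {T : measurableType d} {R : realType}.
Implicit Types (nu : {charge set T -> \bar R}) (D : set T) (g : T -> \bar R).

Definition chosen_hahn_decomposition nu :
    hahn_decomposition nu (sval (cid (Hahn_decomposition nu)))
      (sval (cid (svalP (cid (Hahn_decomposition nu))))) :=
  svalP (cid (svalP (cid (Hahn_decomposition nu)))).

(* The Jordan parts do not depend on which Hahn decomposition is chosen. *)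
Definition charge_integral nu D g : \bar R :=
  (\int[jordan_pos (chosen_hahn_decomposition nu)]_(x in D) g x
   - \int[jordan_neg (chosen_hahn_decomposition nu)]_(x in D) g x)%E.

End signed_integral.

Definition running_max {R : realType} (f : R -> R) (t : R) : R :=
  sup [set f s | s in `[0, t]].

Lemma running_max_is_max (R : realType) (f : R -> R) (T t : R) :
  {within `[0, T], continuous f} -> 0 <= t <= T ->
  (exists2 s, 0 <= s <= t & f s = running_max f t) /\
  (forall s, 0 <= s <= t -> f s <= running_max f t).
Proof.
move=> cf /andP[t0 tT].
have cft : {within `[0, t], continuous f}.
  by apply: continuous_subspaceW cf; exact: subset_itvl.
have [c ct fc] := EVT_max t0 cft.
suff fcE : running_max f t = f c.
  rewrite fcE; split; first by exists c => //; move: ct; rewrite in_itv.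
  by move=> s st; apply: fc; rewrite in_itv.
apply/eqP; rewrite eq_le; apply/andP; split.
  by apply: ge_sup; [exists (f c), c|move=> _ [s st <-]; exact: fc].
by apply: ub_le_sup; [exists (f c) => _ [s st <-]; exact: fc|exists c].
Qed.

(* A signed Borel measure on [0, T] is represented by a (finite) charge on the
   Borel sets of R that vanishes outside [0, T].  Since the increments say
   nothing about {0}, the absence of an atom there has to be required. *)
Record is_lebesgue_stieltjes_charge {R : realType} (T : R) (f : R -> R)
    (mu : {charge set (measurableTypeR R) -> \bar R}) : Prop := {
  ls_charge_increment : forall a b : R, 0 <= a -> a < b -> b <= T ->
    mu `]a, b]%classic = (f b - f a)%:E ;
  ls_charge_atomless : forall x : R, mu [set x] = 0%E ;
  ls_charge_support : forall A : set (measurableTypeR R), measurable A ->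
    A `&` `[0, T] = set0 -> mu A = 0%E }.

Section lebesgue_stieltjes_charge_existence.
Context {R : realType}.
Implicit Types (T x : R) (f : R -> R).

Let neg_tv_measure T f : 0 < T ->
  {in `[0, T[, forall x, f @ x^'+ --> f x} -> bounded_variation 0 T f ->
  exists m : {finite_measure set (measurableTypeR R) -> \bar R},
    (forall a b, 0 <= a -> a < b -> b <= T ->
      m `]a, b]%classic = (fine (neg_tv 0 f b) - fine (neg_tv 0 f a))%:E) /\
    (forall A, A `&` `]0, T] = set0 -> m A = 0%E).
Proof.
move=> T0 cf bvf.
pose cl x : R := Num.max 0 (Num.min x T).
pose g x := fine (neg_tv 0 f x).
have clE x : 0 <= x -> x <= T -> cl x = x.
  by move=> x0 xT; rewrite /cl (min_idPl xT) (max_idPr x0).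
have cl_itv x : cl x \in `[0, T].
  by rewrite in_itv/= le_max lexx/= ge_max (ltW T0)/= ge_min lexx orbT.
have ndG : nondecreasing (g \o cl).
  move=> x y xy /=; apply: (fine_neg_tv_nondecreasing bvf) => //.
  rewrite /cl ge_max le_max lexx/= le_max; apply/orP; right.
  by rewrite le_min !ge_min xy lexx orbT.
have rcG : right_continuous (g \o cl).
  move=> x.
  have [x0|x0] := ltP x 0.
    apply: (@cvg_trans _ (cst (g (cl x)) y @[y --> x^'+])); last exact: cvg_cst.
    apply: near_eq_cvg; near=> y => /=; congr g.
    have y0 : y <= 0 by near: y; exact: nbhs_right_le.
    by rewrite /cl !(min_idPl _) ?(max_idPl _)// ?(le_trans y0 (ltW T0))// ?ltW ?(lt_trans x0 T0).
  have [xT|Tx] := ltP x T.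
    rewrite /= clE// 1?ltW//.
    apply: (@cvg_trans _ (g y @[y --> x^'+])).
      apply: near_eq_cvg; near=> y => /=; congr g.
      have xy : x <= y by near: y; exact: nbhs_right_ge.
      have yT : y <= T by near: y; exact: nbhs_right_le.
      by rewrite clE// (le_trans x0).
    apply: (neg_tv_right_continuous x0 xT bvf).
    by apply: cf; rewrite in_itv/= x0.
  apply: (@cvg_trans _ (cst (g (cl x)) y @[y --> x^'+])); last exact: cvg_cst.
  apply: near_eq_cvg; near=> y => /=; congr g.
  have xy : x <= y by near: y; exact: nbhs_right_ge.
  by rewrite /cl !(min_idPr _)// (le_trans Tx).
pose G : cumulative R R := HB.pack (g \o cl) (isCumulative.Build R _ R (g \o cl) ndG rcG).
have GE a b : a <= b ->
    lebesgue_stieltjes_measure G `]a, b]%classic = (G b - G a)%:E.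
  move=> ab; rewrite -(wlength_itv_bnd G false false)//.
  exact: (measurable_mu_extE (wlength G) (is_ocitv a b)).
have mD : measurable (`]0, T]%classic : set (measurableTypeR R)).
  by apply: sub_sigma_algebra; exact: is_ocitv.
have Doo : (lebesgue_stieltjes_measure G `]0%R, T] < +oo)%E.
  by rewrite GE ?ltW// ltry.
exists (mfrestr mD Doo); split => [a b a0 ab bT|A A0].
  rewrite -[LHS]/(lebesgue_stieltjes_measure G (`]a, b] `&` `]0, T])).
  rewrite setIidl; last first.
    by apply: subset_itv; rewrite bnd_simp.
  rewrite GE 1?ltW//= !clE//.
  - by rewrite (le_trans _ bT)// ltW.
  - by rewrite (le_trans a0)// ltW.
by rewrite -[LHS]/(lebesgue_stieltjes_measure G (A `&` `]0, T])) A0 measure0.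
Unshelve. all: by end_near. Qed.

Lemma lebesgue_stieltjes_charge_exists T f : 0 < T ->
  {within `[0, T], continuous f} -> bounded_variation 0 T f ->
  exists mu, is_lebesgue_stieltjes_charge T f mu.
Proof.
move=> T0 cf bvf.
have rcf : {in `[0, T[, forall x, f @ x^'+ --> f x}.
  move=> x; rewrite in_itv/= => /andP[].
  have [cfi cf0 _] := (continuous_within_itvP f T0).1 cf.
  rewrite le_eqVlt => /predU1P[<- //|x0 xT].
  by apply: cvg_at_right_filter; apply: cfi; rewrite in_itv/= x0.
have rcNf : {in `[0, T[, forall x, (\- f) @ x^'+ --> (\- f) x}.
  by move=> x /rcf cfx; exact: cvgN.
have [m1 [m1E m10]] := neg_tv_measure T0 rcNf (bounded_variationN bvf).
have [m2 [m2E m20]] := neg_tv_measure T0 rcf bvf.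
pose mu := cadd (charge_of_finite_measure m1)
  (copp (charge_of_finite_measure m2)).
have mu_def A : mu A = (m1 A - m2 A)%E by [].
have muE a b : 0 <= a -> a < b -> b <= T -> mu `]a, b]%classic = (f b - f a)%:E.
  move=> a0 ab bT; rewrite mu_def.
  rewrite m1E// m2E// -EFinN -EFinD; congr EFin.
  have fE := bounded_variation_pos_neg_tvE bvf.
  rewrite [in RHS]fE; last by rewrite in_itv/= (le_trans a0 (ltW ab)).
  rewrite [in X in _ = _ - X]fE; last by rewrite in_itv/= a0 (le_trans (ltW ab)).
  rewrite /pos_tv /=; ring.
have mu0 A : A `&` `]0, T] = set0 -> mu A = 0%E.
  move=> A0; rewrite mu_def.
  by rewrite m10// m20// oppe0 adde0.
exists mu; split => // [x|A mA A0]; last first.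
  apply: mu0; rewrite -subset0 -A0; apply: setIS.
  by apply: subset_itvr; rewrite bnd_simp.
have [/andP[x0 xT]|x0T] := boolP (0 < x <= T); last first.
  apply: mu0; rewrite -subset0 => y [/= -> ].
  by rewrite in_itv/= (negbTE x0T).
pose F n : set (measurableTypeR R) := `]x - n.+1%:R^-1, x]%classic.
have mF n : measurable (F n) by apply: sub_sigma_algebra; exact: is_ocitv.
have FI : \bigcap_n F n = [set x] by rewrite set1_bigcap_oc.
have cvgm (m : {finite_measure set (measurableTypeR R) -> \bar R}) :
    m (F n) @[n --> \oo] --> m [set x].
  rewrite -FI; apply: nonincreasing_cvg_mu => //.
  - by rewrite -ge0_fin_numE// fin_num_measure.
  - exact: bigcap_measurable.
  - move=> n k nk; apply/subsetPset; apply: subset_itvr.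
    by rewrite bnd_simp lerD2l lerN2 lef_pV2 ?posrE// ler_nat.
have cmu : mu (F n) @[n --> \oo] --> mu [set x].
  under eq_fun do rewrite mu_def.
  rewrite mu_def; apply: cvgeB => //.
  by apply: fin_num_adde_defl; rewrite fin_numN fin_num_measure// -FI; exact: bigcap_measurable.
have u_x : x - n.+1%:R^-1 @[n --> \oo] --> x.
  rewrite -[X in _ --> X]subr0; apply: cvgB; first exact: cvg_cst.
  exact: cvg_harmonic.
have fx : f (x - n.+1%:R^-1) @[n --> \oo] --> f x.
  have lf : f @ x^'- --> f x.
    have [cfi _ cfT] := (continuous_within_itvP f T0).1 cf.
    move: xT; rewrite le_eqVlt => /predU1P[-> //|xT].
    by apply: cvg_at_left_filter; apply: cfi; rewrite in_itv/= x0.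
  by apply: ((cvg_at_leftP f x (f x)).1 lf); split => // n; rewrite gtrBl invr_gt0.
have cmu0 : mu (F n) @[n --> \oo] --> 0%E.
  apply: (@cvg_trans _ ((f x - f (x - n.+1%:R^-1))%:E @[n --> \oo])).
    apply: near_eq_cvg; near=> n; rewrite muE//.
    - by near: n; exact: (cvgr_ge _ u_x).
    - by rewrite gtrBl invr_gt0.
  apply: cvg_EFin; first exact: nearW.
  rewrite -(subrr (f x)); apply: cvgB => //; exact: cvg_cst.
exact: cvg_unique cmu cmu0.
Unshelve. all: by end_near. Qed.

End lebesgue_stieltjes_charge_existence.

(* Main.v *)
Require Import Defs.
From mathcomp Require Import all_boot all_order all_algebra.
From mathcomp Require Import all_classical all_reals all_analysis measurable_realfun.
Import Order.TTheory GRing.Theory Num.Theory.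
Import numFieldNormedType.Exports.
Local Open Scope classical_set_scope.
Local Open Scope ring_scope.

(* Let [b] be the last point of [0, T] where [f] attains its maximum.  The
   contact set {f^* = f} is [0, b] minus the open set [U] of the points of
   (0, b) where f < f^*.  At both endpoints of a component (x, y) of [U] the
   function [f] equals its running maximum, which does not grow during the
   excursion, so f x = f y and mu (x, y) = 0; since [U] has countably many
   components, mu U = 0.  Hence the integral is mu [0, b] = f b - f 0. *)

(** * Components of bounded open sets, and charges *)

Lemma open_disjoint_itv_endpoints (R : realType) (U : set R) (oU : open U)
    (n : nat) :
  has_lbound U -> has_ubound U -> open_disjoint_itv oU n !=set0 ->
  exists a b : R, [/\ a < b, open_disjoint_itv oU n = `]a, b[%classic,
    ~ U a & ~ U b].
Proof.
move=> lbU ubU In0; set I := open_disjoint_itv oU n.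
have IU : I `<=` U.
  by move=> x Ix; rewrite [U](open_disjoint_itv_bigcup oU); exists n.
have lbI : has_lbound I by exact: subset_has_lbound lbU.
have ubI : has_ubound I by exact: subset_has_ubound ubU.
have IE : I = `]inf I, sup I[%classic.
  have := interval_bounded_interior (@open_disjoint_itv_is_interval _ _ oU n) lbI ubI.
  rewrite (iffLR (interior_id I) (@open_disjoint_itv_open _ _ oU n)).
  by move=> {1}->; apply/seteqP; split => x /=; rewrite in_itv.
(* An endpoint lying in [U] would lie in another interval of the family, which
   is open and would therefore meet [I]. *)
have endpoint c : ~ I c -> (forall e, 0 < e -> exists2 x, I x & ball c e x) ->
    ~ U c.
  move=> nIc cI; rewrite [U](open_disjoint_itv_bigcup oU) => -[m _ Imc].
  have [e /= e0 ceI] : nbhs c (open_disjoint_itv oU m).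
    by apply: open_nbhs_nbhs; split => //; exact: open_disjoint_itv_open.
  have [x Ix /ceI Imx] := cI _ e0.
  have mn : m = n.
    by apply: (@open_disjoint_itv_trivIset _ _ oU m n) => //; exists x.
  by apply: nIc; rewrite /I -mn.
exists (inf I), (sup I); split => //.
- have [x] := In0; rewrite -/I {1}IE /= in_itv/= => /andP[ax xb].
  exact: (@lt_trans _ _ x).
- apply: endpoint => [|e e0]; first by rewrite {1}IE /= in_itv/= ltxx.
  have [x Ix xe] := inf_adherent e0 (conj In0 lbI).
  exists x => //; rewrite /ball/= ler0_norm ?subr_le0 ?ge_inf//.
  by rewrite opprB ltrBlDl.
- apply: endpoint => [|e e0]; first by rewrite {1}IE /= in_itv/= ltxx andbF.
  have [x Ix xe] := sup_adherent e0 (conj In0 ubI).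
  exists x => //; rewrite /ball/= ger0_norm ?subr_ge0 ?ub_le_sup//.
  by rewrite ltrBlDl -ltrBlDr.
Qed.

(** Countable additivity over the components of [U]. Boundedness rules out rays, so every nonempty
    component has two endpoints, both outside [U]. *)
Lemma charge_open_eq0 (R : realType)
    (nu : {charge set (measurableTypeR R) -> \bar R}) (U : set R) :
  open U -> has_lbound U -> has_ubound U ->
  (forall a b, a < b -> ~ U a -> ~ U b -> `]a, b[ `<=` U ->
    nu `]a, b[%classic = 0%E) ->
  nu U = 0%E.
Proof.
move=> oU lbU ubU nu0.
have mI n : measurable (open_disjoint_itv oU n : set (measurableTypeR R)).
  by apply: open_measurable; exact: open_disjoint_itv_open.
have nuI n : nu (open_disjoint_itv oU n) = 0%E.
  have [->|/set0P In0] := eqVneq (open_disjoint_itv oU n) set0.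
    exact: charge0.
  have [a [b [ab IE nUa nUb]]] := open_disjoint_itv_endpoints R U oU n lbU ubU In0.
  rewrite IE; apply: nu0 => //; rewrite -IE => x Ix.
  by rewrite [U](open_disjoint_itv_bigcup oU); exists n.
have := @charge_semi_sigma_additive _ _ _ nu _ mI
  (@open_disjoint_itv_trivIset _ _ oU)
  (bigcup_measurable (fun n _ => mI n)).
rewrite -open_disjoint_itv_bigcup.
under eq_fun do rewrite big1//.
by move/cvg_lim => <- //; rewrite lim_cst.
Qed.

(** Both Jordan parts are measures, and their difference is [nu]. Measurability is asked of the
    trace [A]&[D] only: nothing is known about [f], hence about the contact set, outside
    [[0, T]]. *)
Lemma charge_integral_indic d (T : measurableType d) (R : realType)
    (nu : {charge set T -> \bar R}) (D A : set T) :
  measurable D -> measurable (A `&` D) ->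
  charge_integral nu D (fun x => (\1_A x)%:E) = nu (A `&` D).
Proof.
move=> mD mAD.
have eqAD (m : {measure set T -> \bar R}) :
    (\int[m]_(x in D) (\1_A x)%:E = m (A `&` D))%E.
  transitivity (\int[m]_(x in D) (\1_(A `&` D) x)%:E)%E.
    by apply: eq_integral => x xD; rewrite !indicE in_setI xD andbT.
  by rewrite integral_indic// -setIA setIid.
rewrite /charge_integral !eqAD.
rewrite (jordan_decomp (chosen_hahn_decomposition nu) mAD).
by rewrite /cadd/= cscaleN1.
Qed.

(** * The running maximum: maximisers, contact set, excursions *)

Section running_max.
Context {R : realType} (T : R) (f : R -> R).
Hypotheses (T0 : 0 < T) (cf : {within `[0, T], continuous f}).

Lemma near_lt_within x m : 0 <= x <= T -> f x < m ->
  \forall y \near x, 0 <= y <= T -> f y < m.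
Proof using cf.
move=> xT fxm.
have := (subspace_continuousP _ _).1 cf x xT.
by move=> /cvgr_lt/(_ _ fxm); rewrite near_withinE.
Qed.

Lemma le_running_max s t : 0 <= s <= t -> t <= T -> f s <= running_max f t.
Proof using cf.
move=> /andP[s0 st] tT; have t0 : 0 <= t by exact: le_trans st.
have [|_] := running_max_is_max cf (t := t); first by rewrite t0.
by apply; rewrite s0.
Qed.

Lemma running_max_attained t : 0 <= t <= T ->
  exists2 c, 0 <= c <= t & f c = running_max f t.
Proof using cf. by move/(running_max_is_max cf) => []. Qed.

Lemma running_max0 : running_max f 0 = f 0.
Proof using T0 cf.
have [|c] := running_max_attained 0; first by rewrite lexx ltW.
by rewrite -eq_le => /eqP <-.
Qed.

(** The point is the supremum of the maximisers. Were [f] below its maximum there, continuity would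
    keep it below nearby, yet maximisers come arbitrarily close. *)
Lemma last_argmax : exists2 b, 0 <= b <= T &
  f b = running_max f T /\ (forall t, b < t <= T -> f t < running_max f T).
Proof using T0 cf.
have T0T : 0 <= T <= T by rewrite lexx ltW.
pose S := [set s | 0 <= s <= T /\ f s = running_max f T].
have S0 : S !=set0.
  by have [c c0T fc] := running_max_attained T T0T; exists c; split.
have ubS : has_ubound S by exists T => s [/andP[]].
have b0T : 0 <= sup S <= T.
  apply/andP; split; last by apply: ge_sup => // s [/andP[]].
  have [s Ss] := S0; apply: (@le_trans _ _ s); last exact: ub_le_sup.
  by have [/andP[]] := Ss.
exists (sup S) => //; split=> [|t /andP[bt tT]].
  apply/eqP; rewrite eq_le le_running_max ?lexx//=.
  rewrite leNgt; apply/negP => /(near_lt_within _ _ b0T)[e /= e0 be].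
  have [s Ss bs] := sup_adherent e0 (conj S0 ubS).
  have [sT fsM] := Ss.
  suff : f s < running_max f T by rewrite fsM ltxx.
  apply: be => //; rewrite /ball/= ger0_norm ?subr_ge0 ?ub_le_sup//.
  by rewrite ltrBlDl -ltrBlDr.
have t0 : 0 <= t by rewrite (le_trans _ (ltW bt))//; case/andP: b0T.
rewrite lt_neqAle le_running_max ?t0 ?andbT//.
apply/eqP => ftM; suff : t <= sup S by rewrite leNgt bt.
by apply: ub_le_sup => //; split => //; rewrite t0.
Qed.

(** Continuity of the running maximum is avoided: it is attained at some [c < t], so [f c] bounds it
    from below at every [s] near [t], while [f s < f c] by continuity of [f]. *)
Lemma open_lt_running_max b : b <= T ->
  open [set t | 0 < t < b /\ f t < running_max f t].
Proof using cf.
move=> bT; rewrite openE => t [/andP[t0 tb] ftM].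
have t0T : 0 <= t <= T by rewrite ltW// (le_trans (ltW tb)).
have [c /andP[c0 ct] fc] := running_max_attained t t0T.
have {}ct : c < t.
  rewrite lt_neqAle ct andbT; apply/eqP => ctE.
  by move: ftM; rewrite -fc ctE ltxx.
rewrite -fc in ftM.
rewrite /interior; near=> s.
have cs : c < s by near: s; exact: lt_nbhsr.
have sb : s < b by near: s; exact: lt_nbhsl.
have s0 : 0 < s by near: s; exact: lt_nbhsr.
have sT : s <= T by rewrite (le_trans (ltW sb)).
split; first by rewrite s0.
apply: (@lt_le_trans _ _ (f c)); last by apply: le_running_max => //; rewrite c0 ltW.
suff : 0 <= s <= T -> f s < f c by apply; rewrite ltW.
by near: s; exact: near_lt_within.
Unshelve. all: by end_near. Qed.

(* Before any [t] of the excursion, the running maximum is attained at a point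
   outside the excursion, hence at or before [a]. *)
Lemma excursion_endpoints a b : 0 <= a -> a < b -> b <= T ->
  f a = running_max f a -> f b = running_max f b ->
  (forall t, a < t < b -> f t < running_max f t) -> f a = f b.
Proof using cf.
move=> a0 ab bT faM fbM fltM.
have b0 : 0 <= b by rewrite (le_trans a0)// ltW.
apply/eqP; rewrite eq_le; apply/andP; split.
  by rewrite fbM; apply: le_running_max => //; rewrite a0 ltW.
rewrite leNgt; apply/negP => fab.
have ltab t : a < t < b -> f t < f a.
  move=> tab; have [at_ tb] := andP tab.
  have tT : t <= T by rewrite (le_trans (ltW tb)).
  have t0 : 0 <= t by rewrite (le_trans a0)// ltW.
  have [|c /andP[c0 ct] fc] := running_max_attained t; first by rewrite t0.
  apply: (lt_le_trans (fltM t tab)); rewrite -fc faM.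
  have [ca|ac] := leP c a.
    by apply: le_running_max; rewrite ?c0// (le_trans (ltW ab)).
  (* A maximiser [c] inside the excursion would lie strictly below the running maximum at [c], which
     is at most the one at [t], namely [f c]. *)
  have := fltM c; rewrite ac (le_lt_trans ct tb) => /(_ isT).
  have [|d /andP[d0 dc] <-] := running_max_attained c.
    by rewrite c0 (le_trans ct).
  by rewrite fc ltNge le_running_max// d0 (le_trans dc).
have : f b <= f a; last by rewrite leNgt fab.
have b0T : 0 <= b <= T by rewrite b0.
have := (subspace_continuousP _ _).1 cf b b0T.
move=> /cvgr_gt/(_ _ fab); rewrite near_withinE => -[e /= e0 be].
(* The midpoint keeps [t] in []a, b[], where [f t < f a]; the term [b - e / 2] puts it close enough
   to [b] for [f a < f t]. *)
pose t := Num.max ((a + b) / 2) (b - e / 2).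
have at_ : a < t by rewrite lt_max midf_lt.
have tb : t < b by rewrite gt_max midf_lt//= gtrBl divr_gt0.
have bet : b - e < t.
  by rewrite lt_max ltrD2l ltrN2 [X in _ || X]ltr_pdivrMr// ltr_pMr// ltr1n orbT.
have : f a < f t.
  apply: be; last by rewrite /= in_itv/= (le_trans a0) ?(le_trans (ltW tb))// ltW.
  by rewrite /ball/= gtr0_norm ?subr_gt0// ltrBlDl -ltrBlDr.
by rewrite ltNge ltW// ltab// at_.
Qed.
End running_max.

(** * Evaluation of the integral over the contact set *)

Theorem theorem3p1 (R : realType) (T : R) (f : R -> R)
    (mu : {charge set (measurableTypeR R) -> \bar R})
    (hT : 0 < T)
    (hcont : {within `[0, T], continuous f})
    (hbv : bounded_variation 0 T f)
    (hmu : is_lebesgue_stieltjes_charge T f mu) :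
  (running_max f T)%:E =
  ((f 0)%:E +
   charge_integral mu `[0%R, T]
     (fun t : measurableTypeR R =>
        (\1_[set s : R | running_max f s = f s] t)%:E))%E.
Proof.
have mitv (i : interval R) : measurable ([set` i] : set (measurableTypeR R)).
  exact: measurable_itv.
have [b /andP[b0 bT] [fb fltb]] := last_argmax _ _ hT hcont.
have rmM s t : 0 <= s <= t -> t <= T -> running_max f s <= running_max f t.
  move=> /andP[s0 st] tT.
  have [|c /andP[c0 cs] <-] := running_max_attained _ _ hcont s.
    by rewrite s0 (le_trans st).
  by apply: (le_running_max _ _ hcont) => //; rewrite c0 (le_trans cs).
have rmb : f b = running_max f b.
  apply/eqP; rewrite eq_le (le_running_max _ _ hcont) ?b0//= fb.
  by rewrite rmM ?b0.
have rm0 := running_max0 _ _ hT hcont.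
pose U := [set t | 0 < t < b /\ f t < running_max f t].
have oU : open U by exact: open_lt_running_max hcont _ bT.
have mU : measurable (U : set (measurableTypeR R)) by exact: open_measurable.
have notU t : 0 <= t <= b -> ~ U t -> f t = running_max f t.
  move=> /andP[]; rewrite le_eqVlt => /predU1P[<- //|t0].
  rewrite le_eqVlt => /predU1P[-> //|tb] nUt.
  apply/eqP; rewrite eq_le; apply/andP; split.
    by apply: (le_running_max _ _ hcont); rewrite ?lexx ?andbT ?ltW// (lt_le_trans tb).
  by rewrite leNgt; apply/negP => ft; apply: nUt; split => //; rewrite t0.
have muU : mu U = 0%E.
  apply: charge_open_eq0 => //.
  - by exists 0 => t [/andP[/ltW]].
  - by exists b => t [/andP[_ /ltW]].
  move=> x y xy nUx nUy xyU.
  have xyU' t : x < t < y -> 0 < t < b /\ f t < running_max f t.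
    by move=> txy; apply: xyU; rewrite /= in_itv.
  (* If [x] were negative, the midpoint of [x] and [Num.min y 0] would be a negative point of []x,
     y[], hence of [U]. The bound on [y] is symmetric. *)
  have x0 : 0 <= x.
    rewrite leNgt; apply/negP => x0.
    have m0 : Num.min y 0 <= 0 by rewrite ge_min lexx orbT.
    have xm : x < Num.min y 0 by rewrite lt_min xy.
    have [|/andP[+ _] _] := xyU' ((x + Num.min y 0) / 2).
      by rewrite midf_lt//= (lt_le_trans (midf_lt xm).2)// ge_min lexx.
    by rewrite ltNge (le_trans (ltW (midf_lt xm).2)).
  have yb : y <= b.
    rewrite leNgt; apply/negP => yb.
    have bm : b <= Num.max x b by rewrite le_max lexx orbT.
    have my : Num.max x b < y by rewrite gt_max xy.
    have [|/andP[_ +] _] := xyU' ((Num.max x b + y) / 2).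
      by rewrite midf_lt//= andbT (le_lt_trans _ (midf_lt my).1)// le_max lexx.
    by rewrite ltNge (le_trans bm (ltW (midf_lt my).1)).
  have yT : y <= T by exact: le_trans yb bT.
  have fxy : f x = f y.
    apply: (excursion_endpoints _ _ hcont x y) => //.
    - by apply: notU; rewrite // x0 (le_trans (ltW xy)).
    - by apply: notU; rewrite // yb (le_trans x0 (ltW xy)).
    - by move=> t /xyU'[].
  have := ls_charge_increment hmu x0 xy yT.
  (* Increments are known on half-open intervals; the atomless point [y] is split off to reach the
     open one. *)
  rewrite fxy subrr -(@setUitv1 _ _ _ _ true) ?bnd_simp//.
  rewrite chargeU//; last first.
    by apply/seteqP; split => // t [/[swap] ->]; rewrite /= in_itv/= ltxx andbF.
  by rewrite (ls_charge_atomless hmu) adde0.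
(* No contact occurs after [b]: there [f] is below its overall maximum, which the running maximum
   has already reached at [b]. *)
have contactE : [set s : R | running_max f s = f s] `&` `[0, T] = `[0, b] `\` U.
  apply/seteqP; split=> t /=; rewrite !in_itv/=.
    move=> [ftE /andP[t0 tT]]; split.
      rewrite t0/= leNgt; apply/negP => bt.
      have := fltb t; rewrite bt tT => /(_ isT).
      by rewrite -ftE -fb rmb ltNge rmM// b0 ltW.
    by case=> _; rewrite ftE ltxx.
  move=> [/andP[t0 tb] nUt]; split; first by rewrite -notU ?t0.
  by rewrite t0 (le_trans tb).
(* The increment gives only []0, b]], and only for [0 < b]; the point 0 is added as a null atom. *)
have muD : mu `[0, b]%classic = (f b - f 0)%:E.
  have [<-|b_neq0] := eqVneq 0 b.
    by rewrite set_itv1 (ls_charge_atomless hmu) subrr.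
  rewrite -(@setU1itv _ _ _ _ false) ?bnd_simp// chargeU//.
  - rewrite (ls_charge_atomless hmu) add0e (ls_charge_increment hmu)//.
    by rewrite lt_neqAle b_neq0.
  - by apply/seteqP; split => // t [->]; rewrite /= in_itv/= ltxx.
rewrite charge_integral_indic//; last first.
  by rewrite contactE; exact: measurableD.
rewrite contactE chargeD// setIidr; last first.
  by move=> t [/andP[t0 tb] _]; rewrite /= in_itv/= !ltW.
by rewrite muD muU sube0 -EFinD addrC subrK fb.
Qed.
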